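(* Let $X$ be a Banach space. Then $\widetilde{H}^2(X)=C'_{\mathrm{NJ}}(X)$, where $$\widetilde{H}^{2}(X)=\sup\left\{\frac{\|x\|^2+\|y\|^2}{\|x+y\|^2}: x,y\in X,\ (x,y)\neq(0,0),\ x\perp_I y\right\}$$ and $$C'_{\mathrm{NJ}}(X)=\sup\left\{\frac{\|x+y\|^2+\|x-y\|^2}{4}: x,y\in S_X\right\}.$$
   Context: $S_X=\{x\in X:\|x\|=1\}$ is the unit sphere of $X$. Isosceles orthogonality: $x\perp_I y$ means $\|x+y\|=\|x-y\|$. The symbol $\widetilde{H}^2(X)$ is the name of a constant (not the square of another constant). *)

(* Defs.v *)
From HB Require Import structures.
From mathcomp Require Import all_boot all_order all_algebra.
From mathcomp Require Import all_classical all_reals all_analysis.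

Set Implicit Arguments.
Unset Strict Implicit.
Unset Printing Implicit Defensive.

Import Order.TTheory GRing.Theory Num.Theory.
Import numFieldNormedType.Exports.

Local Open Scope classical_set_scope.
Local Open Scope ring_scope.

Definition unit_sphere (R : realType) (X : normedModType R) : set X :=
  [set x | `|x| = 1].
Arguments unit_sphere {R} X _.

Definition isosceles_orthogonal (R : realType) (X : normedModType R)
    (x y : X) : Prop :=
  `|x + y| = `|x - y|.

(* The suprema below are taken in the extended reals, where every set has one,
   so that no boundedness or nonemptiness convention is hidden in them
   (for X = 0, [CNJ'] is the supremum of the empty set, -oo, and so is
   [Htilde2]).  In [Htilde2] the denominator never vanishes: x + y = 0 and
   isosceles orthogonality force x = y = 0. *)

Definition Htilde2 (R : realType) (X : normedModType R) : \bar R :=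
  ereal_sup [set r : \bar R | exists x y : X,
    [/\ (x, y) <> (0, 0), isosceles_orthogonal x y &
        r = ((`|x| ^+ 2 + `|y| ^+ 2) / `|x + y| ^+ 2)%:E]].

Definition CNJ' (R : realType) (X : normedModType R) : \bar R :=
  ereal_sup [set r : \bar R | exists x y : X,
    [/\ unit_sphere X x, unit_sphere X y &
        r = ((`|x + y| ^+ 2 + `|x - y| ^+ 2) / 4)%:E]].

(* Main.v *)
(* The map (x, y) |-> ((x + y) / N, (x - y) / N), with N = `|x + y|, sends
   nonzero isosceles orthogonal pairs to pairs of unit vectors, with section
   (u, v) |-> ((u + v) / 2, (u - v) / 2); it matches the two quotients, so both
   suprema are taken over the same set. *)
Require Import Defs.
From HB Require Import structures.
From mathcomp Require Import all_boot all_order all_algebra.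
From mathcomp Require Import all_classical all_reals all_analysis.
From mathcomp Require Import ring.

Set Implicit Arguments.
Unset Strict Implicit.
Unset Printing Implicit Defensive.

Import Order.TTheory GRing.Theory Num.Theory.
Import numFieldNormedType.Exports.

Local Open Scope ring_scope.

(** The scalar stays general to serve twice: [2^-1] inverts the change of variables, and the inverse
    of [|x + y|] normalizes it. *)
Lemma scale_addDB (R : pzRingType) (V : lmodType R) (c : R) (x y : V) :
  c *: (x + y) + c *: (x - y) = (c * 2) *: x.
Proof.
by rewrite -scalerDr addrACA subrr addr0 -scalerA scaler_nat mulr2n.
Qed.

Lemma scale_subDB (R : pzRingType) (V : lmodType R) (c : R) (x y : V) :
  c *: (x + y) - c *: (x - y) = (c * 2) *: y.
Proof. by rewrite -scalerN opprB [x + y]addrC scale_addDB. Qed.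

Lemma half_addDB (R : numFieldType) (V : lmodType R) (x y : V) :
  2^-1 *: (x + y) + 2^-1 *: (x - y) = x.
Proof. by rewrite scale_addDB mulVf ?scale1r ?pnatr_eq0. Qed.

Lemma half_subDB (R : numFieldType) (V : lmodType R) (x y : V) :
  2^-1 *: (x + y) - 2^-1 *: (x - y) = y.
Proof. by rewrite scale_subDB mulVf ?scale1r ?pnatr_eq0. Qed.

(** If [x + y] vanishes, orthogonality makes [x - y] vanish too, and these two determine [x] and
    [y]. *)
Lemma isosceles_orthogonal_norm_neq0 (R : realType) (X : normedModType R)
    (x y : X) :
  (x, y) <> (0, 0) -> isosceles_orthogonal x y -> `|x + y| != 0.
Proof.
move=> xy0 xy; apply/eqP => N0; apply: xy0.
have D0 : x + y = 0 by apply/normr0_eq0.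
have B0 : x - y = 0 by apply/normr0_eq0; rewrite -xy.
by congr (_, _); [rewrite -(half_addDB x y)|rewrite -(half_subDB x y)];
  rewrite D0 B0 scaler0 ?subr0 ?addr0.
Qed.

Theorem theorem2p9 (R : realType) (X : completeNormedModType R) :
  Htilde2 X = CNJ' X.
Proof.
congr ereal_sup; apply/seteqP; split => r [x [y [h1 h2 ->]]].
- have N0 := isosceles_orthogonal_norm_neq0 h1 h2.
  pose c := `|x + y|^-1.
  have cE : `|c| = c by rewrite ger0_norm ?invr_ge0.
  exists (c *: (x + y)), (c *: (x - y)); split.
  + by rewrite /unit_sphere /= normrZ cE mulVf.
  + by rewrite /unit_sphere /= normrZ cE -h2 mulVf.
  (* The norms become [2 * c * |x|] and [2 * c * |y|]; squaring yields a factor 4 that cancels the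
     denominator. *)
  + rewrite scale_addDB scale_subDB (normrZ _ x) (normrZ _ y) normrM cE (ger0_norm (ler0n R 2)) /c.
    by congr EFin; field.
- rewrite /unit_sphere /= in h1 h2.
  exists (2^-1 *: (x + y)), (2^-1 *: (x - y)); split.
  (* If both halves vanish, so does their sum [x], contradicting [|x| = 1]. *)
  + case=> D0 B0; move: (half_addDB x y) h1; rewrite D0 B0 addr0 => <-.
    by move/eqP; rewrite normr0 eq_sym oner_eq0.
  + by rewrite /isosceles_orthogonal half_addDB half_subDB h1 h2.
  (* The denominator is [|x| ^+ 2 = 1]; the squared halves supply the [1 / 4]. *)
  + rewrite half_addDB h1 !normrZ ger0_norm ?invr_ge0 ?ler0n //.
    by congr EFin; field.
Qed.
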